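(* Let $G$ be a finite group. Then $G$ is $(2,9)$-centralizer if and only if one of the following holds: $G\cong D_{14}$; $G\cong Hol(\mathbb{Z}_7)$; $G$ is a non-abelian group of order $21$; or $G$ is an $8$-centralizer group with $Z(G)\neq 1$. Moreover, $G$ is primitive $(2,9)$-centralizer if and only if $G\cong D_{14}$, $G\cong Hol(\mathbb{Z}_7)$, or $G$ is a non-abelian group of order $21$.
   Context: All groups are finite. $Z(G)$ denotes the center of $G$. For a group $G$, $Cent(G)=\{C_G(x)\mid x\in G\}$ and $2\text{-}Cent(G) = \{ C_G(\{x,y\}) \mid x,y\in G,\ x\neq y\}$, where $C_G(\{x,y\}) = C_G(x)\cap C_G(y)$. A group $G$ is called $n$-centralizer if $|Cent(G)|=n$, $(2,n)$-centralizer if $|2\text{-}Cent(G)| = n$, and primitive $(2,n)$-centralizer if $|2\text{-}Cent(G)| = |2\text{-}Cent(G/Z(G))| = n$. $D_{2n}$ is the dihedral group of order $2n$, $\mathbb{Z}_n$ the cyclic group of order $n$, and $Hol(H)=H\rtimes \mathrm{Aut}(H)$ the holomorph of a group $H$. *)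

(* Defs.v *)
From mathcomp Require Import all_boot all_algebra all_fingroup all_solvable.

Set Implicit Arguments.
Unset Strict Implicit.
Unset Printing Implicit Defensive.

Local Open Scope group_scope.

Section Centralizers.

Variables (gT : finGroupType) (G : {group gT}).

Definition Cent : {set {set gT}} := [set 'C_G[x] | x in G].

Definition two_Cent : {set {set gT}} :=
  [set 'C_G([set x; y]) | x in G, y in G & x != y].

Definition n_centralizer (n : nat) : Prop := #|Cent| = n.

Definition two_n_centralizer (n : nat) : Prop := #|two_Cent| = n.

Lemma cent_pair (x y : gT) : 'C_G([set x; y]) = 'C_G[x] :&: 'C_G[y].
Proof. by rewrite centU !cent_set1; apply: setIIr. Qed.

End Centralizers.

Definition primitive_two_n_centralizer
    (gT : finGroupType) (G : {group gT}) (n : nat) : Prop :=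
  two_n_centralizer G n /\ two_n_centralizer (G / 'Z(G))%G n.

(* The external semidirect product of H by Aut H for the natural action. *)
Definition Hol (gT : finGroupType) (H : {group gT}) : finGroupType :=
  sdprod_by [Aut H].

(* Main.v *)
Require Import Defs.
From mathcomp Require Import all_boot all_algebra all_fingroup all_solvable.
From mathcomp Require Import zify.

Set Implicit Arguments.
Unset Strict Implicit.
Unset Printing Implicit Defensive.

(** Let [C] be the set of centralizers of noncentral elements and [M] the set of
pairwise intersections of members of [C]. Then [2-Cent(G)] is [M], with [G]
added when the center is nontrivial. If all members of [C] are abelian they
pairwise meet in the center, so [M] has one element more than [C].

Suppose some member of [C] is nonabelian, and let [H = C(x)] be a largest such
one. At least four members of [C] contain [x], namely [H], [C(y1)], [C(y2)] and
[C(y1 y2)] for noncommuting [y1, y2] in [H]. The others have to cover a coset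
[uH] by the sets of elements sharing a centralizer [C(v)], each contained in
[v (Z(C(v)) :&: H)], where [Z(C(v)) :&: H] has index at least 4 in [H]. Counting
more carefully in [M] gives [|C| >= 8] and [|M| >= 10], so [C] consists of
abelian groups in all the cases of interest.

When the center is trivial and [C] consists of 8 abelian groups, these partition
[G]; a size estimate gives [|X| <= 7] for [X] in [C] and [|G| <= 49]. Each [X] is
a Hall subgroup and those of equal order are conjugate, and the class equation
then forces a normal, self-centralizing [X] of order 7. Finally, [|C|] does not
increase from [G] to [Q = G / Z(G)], and if it stays the same then [Z(Q)] is
trivial; this leaves no primitive group with nontrivial center. *)

Local Open Scope group_scope.

(** * Centralizers of noncentral elements and their meets *)

Section ProperCentralizers.

Variables (gT : finGroupType) (G : {group gT}).

Definition proper_cents : {set {set gT}} := [set 'C_G[x] | x in G :\: 'Z(G)].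

Definition cent_meets : {set {set gT}} :=
  [set 'C_G[x] :&: 'C_G[y] | x in G :\: 'Z(G), y in G :\: 'Z(G)].
End ProperCentralizers.

Section Basics.

Variables (gT : finGroupType) (G : {group gT}).
Implicit Types (x y z : gT) (X Y : {set gT}).

Lemma mem_center x : (x \in 'Z(G)) = (x \in G) && ('C_G[x] == G).
Proof.
rewrite in_setI; case: (boolP (x \in G)) => //= xG.
by rewrite -sub_cent1 (sameP setIidPl eqP).
Qed.

Lemma cent1_eq_center x : x \in G -> ('C_G[x] == G :> {set gT}) = (x \in 'Z(G)).
Proof. by move=> xG; rewrite mem_center xG. Qed.

Lemma mem_cent1C x y : x \in G -> y \in 'C_G[x] -> x \in 'C_G[y].
Proof. by move=> xG /setIP[yG cxy]; rewrite inE xG cent1C. Qed.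

Lemma cent1_id x : x \in G -> x \in 'C_G[x].
Proof. by move=> xG; rewrite inE xG cent1id. Qed.

Lemma proper_centsP X :
  reflect (exists2 x, x \in G :\: 'Z(G) & X = 'C_G[x]) (X \in proper_cents G).
Proof. exact: imsetP. Qed.

Lemma mem_proper_cents x : x \in G -> x \notin 'Z(G) -> 'C_G[x] \in proper_cents G.
Proof. by move=> xG nx; apply: imset_f; rewrite in_setD nx. Qed.

Lemma sub_cent_meets x y :
    x \in G -> x \notin 'Z(G) -> y \in G -> y \notin 'Z(G) ->
  'C_G[x] :&: 'C_G[y] \in cent_meets G.
Proof. by move=> xG nx yG ny; apply: imset2_f; rewrite in_setD ?nx ?ny. Qed.

Lemma cent1_meet x : x \in G -> x \notin 'Z(G) -> 'C_G[x] \in cent_meets G.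
Proof. by move=> xG nx; rewrite -[X in X \in _]setIid; apply: sub_cent_meets. Qed.

Lemma proper_cents_meets : proper_cents G \subset cent_meets G.
Proof.
apply/subsetP=> _ /proper_centsP[x /setDP[xG nx] ->].
exact: cent1_meet.
Qed.

Lemma group_notin_meets : (G : {set gT}) \notin cent_meets G.
Proof.
apply/imset2P=> -[x y /setDP[xG nx] _ E]; move/negP: nx; apply.
by rewrite -cent1_eq_center // eqEsubset subsetIl {1}E subsetIl.
Qed.

Lemma card_Cent : #|Cent G| = #|proper_cents G|.+1.
Proof.
have nG : (G : {set gT}) \notin proper_cents G.
  by apply: contra group_notin_meets; apply: (subsetP proper_cents_meets).
suff -> : Cent G = (G : {set gT}) |: proper_cents G by rewrite cardsU1 nG.
apply/setP=> X; rewrite in_setU1; apply/imsetP/orP=> [[x xG ->]|[/eqP->|]].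
- have [|nx] := boolP (x \in 'Z(G)); last by right; apply: mem_proper_cents.
  by rewrite -cent1_eq_center //; left.
- by exists 1 => //; apply/esym/eqP; rewrite cent1_eq_center.
- by case/proper_centsP=> x /setDP[xG _] ->; exists x.
Qed.

(** The condition [x != y] loses no meet of noncentral centralizers, since ['C_G[x]] is also
    obtained from the pair [x], [1]. It matters only for [G] itself, which needs two distinct
    central elements. *)
Lemma card_two_Cent : #|two_Cent G| = (#|cent_meets G| + ('Z(G) != 1%g))%N.
Proof.
have GZ z : z \in 'Z(G) -> 'C_G[z] = G.
  by move=> zZ; apply/eqP; rewrite cent1_eq_center // (subsetP (center_sub G)).
have two_CentP X : reflect (exists x y, [/\ x \in G, y \in G, x != y &
    X = 'C_G[x] :&: 'C_G[y]]) (X \in two_Cent G).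
  apply: (iffP imset2P) => [[x y xG]|[x [y [xG yG xy ->]]]].
    by rewrite inE => /andP[yG xy] ->; exists x, y; split=> //; rewrite cent_pair.
  by exists x y; rewrite ?inE ?yG ?cent_pair.
have [Z1|ntZ] /= := eqVneq 'Z(G) 1.
  rewrite addn0; congr #|pred_of_set _|; apply/setP=> X.
  apply/two_CentP/idP=> [[x [y [xG yG xy ->]]]|/imset2P[x y]].
    wlog nx : x y xG yG xy / x != 1.
      move=> IH; have [x1|] := eqVneq x 1; last exact: IH.
      by rewrite setIC; apply: IH; rewrite // 1?eq_sym -?x1.
    have [y1|ny] := eqVneq y 1; last by apply: sub_cent_meets; rewrite // Z1 inE.
    rewrite y1 (GZ 1) // setIAC setIid.
    by apply: cent1_meet; rewrite // Z1 inE.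
  rewrite Z1 => /setDP[xG nx] /setDP[yG ny] ->.
  have [<-|xy] := eqVneq x y; last by exists x, y.
  exists x, 1; rewrite xG group1 (GZ 1) // setIid setIAC setIid.
  by split=> //; rewrite inE in nx.
rewrite addn1; suff -> : two_Cent G = (G : {set gT}) |: cent_meets G.
  by rewrite cardsU1 group_notin_meets.
have [z zZ nz] := trivgPn _ ntZ; have zG := subsetP (center_sub G) _ zZ.
apply/setP=> X; rewrite in_setU1; apply/two_CentP/orP=> [[x [y [xG yG xy ->]]]|].
  have [xZ|nx] := boolP (x \in 'Z(G)).
    have [yZ|ny] := boolP (y \in 'Z(G)); first by left; rewrite !GZ // setIid.
    right; rewrite (GZ x) // setIA setIid; exact: cent1_meet.
  right; have [yZ|ny] := boolP (y \in 'Z(G)); last exact: sub_cent_meets.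
  rewrite (GZ y) // setIAC setIid; exact: cent1_meet.
case=> [/eqP->|/imset2P[x y /setDP[xG nx] /setDP[yG ny] ->]].
  by exists z, 1; rewrite zG group1 !GZ // setIid.
have [<-|xy] := eqVneq x y; last by exists x, y.
exists x, 1; rewrite xG group1 (GZ 1) // setIid setIAC setIid; split=> //.
by apply: contraNneq nx => ->; apply: group1.
Qed.

End Basics.

(** * Groups whose noncentral elements have abelian centralizers *)

Section AbelianCentralizers.

Variables (gT : finGroupType) (G : {group gT}).
Implicit Types (x y z : gT) (X Y : {set gT}).

Definition abelian_cents := forall x, x \in G -> x \notin 'Z(G) -> abelian 'C_G[x].

Lemma nonabelian_noncentral : ~~ abelian G ->
  exists x y, [/\ x \in G, y \in G, x \notin 'Z(G), y \notin 'Z(G) & x \notin 'C[y]].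
Proof.
case/subsetPn=> x xG /centP ncx.
have /existsP[y] : [exists y, (y \in G) && (x \notin 'C[y])].
  apply: contra_notT ncx; rewrite negb_exists => /forallP nc y yG.
  by have := nc y; rewrite yG /= negbK => /cent1P.
case/andP=> yG nxy; exists x, y; split=> //.
  apply: contra nxy; rewrite inE => /andP[_ /centP cx].
  by apply/cent1P; apply: cx.
apply: contra nxy; rewrite inE => /andP[_ /centP cy].
by rewrite cent1C; apply/cent1P; apply: cy.
Qed.

Hypothesis abC : abelian_cents.

(** ['C_G[x]] is abelian and contains [y], hence lies in ['C_G[y]]; the situation is symmetric in
    [x] and [y]. *)
Lemma abelian_cents_eq x y :
  x \in G -> x \notin 'Z(G) -> y \in 'C_G[x] -> y \notin 'Z(G) -> 'C_G[y] = 'C_G[x].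
Proof.
move=> xG nx cyx ny; have [yG _] := setIP cyx.
have half u v : u \in G -> u \notin 'Z(G) -> v \in 'C_G[u] ->
  'C_G[u] \subset 'C_G[v].
  move=> uG nu cvu; rewrite subsetI subsetIl sub_cent1.
  exact: subsetP (abC uG nu) _ cvu.
by apply/eqP; rewrite eqEsubset !half //; apply: mem_cent1C.
Qed.

Lemma abelian_cents_meet x y : x \in G -> x \notin 'Z(G) -> y \in G ->
  y \notin 'Z(G) -> 'C_G[x] != 'C_G[y] -> 'C_G[x] :&: 'C_G[y] = 'Z(G).
Proof.
move=> xG nx yG ny /eqP nxy; apply/eqP; rewrite eqEsubset; apply/andP; split.
  apply/subsetP=> z /setIP[czx czy]; apply: contra_notT nxy => nz.
  by rewrite -(abelian_cents_eq xG nx czx nz) (abelian_cents_eq yG ny czy nz).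
by rewrite subsetI !setIS // -cent_set1 centS ?sub1set.
Qed.

(** The one additional meet is ['Z(G)]: it is no centralizer of a noncentral element, and a
    noncommuting pair realizes it. *)
Lemma card_meets_abelian : ~~ abelian G -> #|cent_meets G| = #|proper_cents G|.+1.
Proof.
move=> nabG; have nZ : 'Z(G) \notin proper_cents G.
  by apply/proper_centsP=> -[x /setDP[xG nx] E]; rewrite E cent1_id in nx.
suff -> : cent_meets G = 'Z(G) |: proper_cents G by rewrite cardsU1 nZ.
apply/setP=> X; rewrite in_setU1; apply/idP/orP.
  case/imset2P=> x y /setDP[xG nx] /setDP[yG ny] ->.
  have [->|nxy] := eqVneq 'C_G[x] 'C_G[y].
    by right; rewrite setIid mem_proper_cents.
  by left; rewrite abelian_cents_meet.
case=> [/eqP->|]; last exact: (subsetP (proper_cents_meets G)).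
have [x [y [xG yG nx ny nxy]]] := nonabelian_noncentral nabG.
rewrite -(abelian_cents_meet xG nx yG ny) ?sub_cent_meets //.
by apply: contra nxy => /eqP E; have := cent1_id xG; rewrite E inE xG.
Qed.

End AbelianCentralizers.

(** * Counting in the presence of a nonabelian centralizer *)

Lemma proper_card2 (gT : finGroupType) (A B : {group gT}) :
  A \proper B -> (2 * #|A| <= #|B|)%N.
Proof.
case/andP=> sAB nsBA; rewrite -(Lagrange sAB) mulnC leq_mul2l.
by rewrite indexg_gt1 nsBA orbT.
Qed.

Lemma proper_card4 (gT : finGroupType) (A B C : {group gT}) :
  A \proper B -> B \proper C -> (4 * #|A| <= #|C|)%N.
Proof. by move=> /proper_card2 + /proper_card2; lia. Qed.

Section NonabelianCentralizers.

Variables (gT : finGroupType) (G : {group gT}).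
Implicit Types (x y z u v : gT) (X Y D : {set gT}).

(* The coset [u *: 'C_G[x]] splits according to the centralizer of its elements,
   and the part of [v] lies in [v *: ('Z('C_G[v]) :&: 'C_G[x])]. *)
Lemma card_cents_avoiding k x u :
    x \in G -> u \in G -> u \notin 'C_G[x] ->
    (forall v, v \in G -> v \notin 'C_G[x] ->
       k * #|'Z('C_G[v]) :&: 'C_G[x]| <= #|'C_G[x]|)%N ->
  (k <= #|[set X in proper_cents G | x \notin X]|)%N.
Proof.
move=> xG uG nux kle; set H := 'C_G[x]; set T := [set X in _ | _].
have uHn v : v \in u *: H -> v \in G /\ v \notin H.
  case/lcosetP=> h hH ->; have [hG _] := setIP hH.
  by rewrite groupM ?groupMr.
have toT v : v \in u *: H -> 'C_G[v] \in T.
  case/uHn=> vG nvx; have nxv : x \notin 'C_G[v].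
    by apply: contra nvx; apply: mem_cent1C.
  rewrite inE nxv andbT mem_proper_cents //; apply: contra nxv => vZ.
  by rewrite (eqP (_ : 'C_G[v] == G)) // cent1_eq_center.
have [->//|k_gt0] := posnP k.
have := card_lcoset H u; rewrite -sum1_card (partition_big _ _ toT) /= => EH.
have bnd X : (\sum_(v in u *: H | 'C_G[v] == X) 1 <= #|H| %/ k)%N.
  case: (pickP [pred v | (v \in u *: H) && ('C_G[v] == X)]) => [v|none]; last first.
    by rewrite big_pred0.
  case/andP=> vuH /eqP EX; have [vG nvx] := uHn v vuH.
  rewrite sum1_card leq_divRL // mulnC; apply: leq_trans (kle v vG nvx).
  rewrite leq_mul2l -(card_lcoset _ v) subset_leq_card ?orbT //.
  apply/subsetP=> w /andP[wuH /eqP Ew]; have [wG _] := uHn w wuH.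
  rewrite mem_lcoset inE -/H.
  have -> : (v^-1 * w \in H) by rewrite -mem_lcoset (lcoset_eqP vuH).
  have vZ : v \in 'Z('C_G[v]) by rewrite inE cent1_id // -sub_cent1 subsetIr.
  have wZ : w \in 'Z('C_G[v]).
    by rewrite EX -Ew inE cent1_id // -sub_cent1 subsetIr.
  by rewrite groupM ?groupV.
have: (#|H| <= #|T| * (#|H| %/ k))%N.
  by rewrite -{1}EH -sum_nat_const leq_sum.
have : (0 < #|H|)%N by apply: cardG_gt0.
have := leq_trunc_div #|H| k; move: (_ %/ _)%N => q le_qk Hgt0 leH.
(* With [q] the floor of [#|H| / k], fewer than [k] members would give
   [(#|T| + 1) q <= k q <= #|H| <= #|T| q], so [q = 0] and then [#|H| = 0]. *)
rewrite leqNgt; apply/negP=> ltTk.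
have : (#|T|.+1 * q <= k * q)%N by rewrite leq_mul2r ltTk orbT.
move: leH le_qk Hgt0; rewrite mulSn (mulnC k).
case: q => [|q]; first by rewrite muln0; lia.
by move: (#|T| * _)%N (_ * k)%N #|H|; lia.
Qed.

Lemma card_by_mem (T : {set {set gT}}) x :
  #|T| = (#|[set X in T | x \in X]| + #|[set X in T | x \notin X]|)%N.
Proof.
rewrite -(cardsID [set X : {set gT} | x \in X] T).
by congr (_ + _)%N; congr #|pred_of_set _|; apply/setP=> X; rewrite !inE // andbC.
Qed.

Lemma uniq_size_card (I : finType) (A : {set I}) (s : seq I) :
  uniq s -> {subset s <= A} -> (size s <= #|A|)%N.
Proof.
by move=> Us sA; rewrite -(card_uniqP Us); apply/subset_leq_card/subsetP.
Qed.

Section LargestCentralizer.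

Variable x : gT.
Hypotheses (xG : x \in G) (nx : x \notin 'Z(G)) (nabH : ~~ abelian 'C_G[x]).
Hypothesis maxH : forall z, z \in G -> z \notin 'Z(G) -> ~~ abelian 'C_G[z] ->
  (#|'C_G[z]| <= #|'C_G[x]|)%N.

Let H := 'C_G[x]%G.

Let sHG : H \subset G. Proof. exact: subsetIl. Qed.

Let xZH : x \in 'Z(H). Proof. by rewrite inE cent1_id // -sub_cent1 subsetIr. Qed.

(** ['C_G[z]] contains [H], so it is nonabelian as well, and the maximality of [H] applies to it. *)
Lemma largest_cent1 z : z \in 'Z(H) -> z \notin 'Z(G) -> 'C_G[z] = H.
Proof.
case/setIP=> zH cHz nz; have zG := subsetP sHG z zH.
have sHC : H \subset 'C_G[z] by rewrite subsetI sHG sub_cent1.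
apply/esym/eqP; rewrite eqEcard sHC maxH //.
by apply: contra nabH; apply: abelianS.
Qed.

Lemma cent1_neq_center y z : y \in H -> z \notin 'C_G[y] -> z \in G ->
  y \notin 'Z(G).
Proof.
move=> yH nzy zG; have yG := subsetP sHG y yH.
by apply: contra nzy; rewrite -cent1_eq_center // => /eqP->.
Qed.

(** The factor 4 comes from the strict chain [B < B Z(H) < H]: [x] lies in ['Z(H)] but not in [B],
    as it does not commute with [v], and [B Z(H)] is abelian while [H] is not. *)
Lemma center_meet_card4 v : v \in G -> v \notin H ->
  (4 * #|'Z('C_G[v]) :&: H| <= #|H|)%N.
Proof.
move=> vG nvH; pose B := ('Z('C_G[v]) :&: H)%G.
have nxB : x \notin B.
  apply: contra nvH => /setIP[xZ _]; apply: mem_cent1C => //.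
  exact: subsetP (center_sub _) x xZ.
have abBZ : abelian (B <*> 'Z(H)).
  rewrite abelianY (abelianS (subsetIl _ _) (center_abelian _)) center_abelian /=.
  exact: subset_trans (subsetIr _ _) (centS (subsetIr _ _)).
have sBB : B \proper B <*> 'Z(H).
  apply/properP; split; first exact: joing_subl.
  by exists x; rewrite // (subsetP (joing_subr _ _)).
have sBH : B <*> 'Z(H) \proper H.
  rewrite properEneq join_subG subsetIr center_sub !andbT.
  by apply: contraNneq nabH => <-.
exact: proper_card4 sBB sBH.
Qed.

(** Under the first hypothesis the intersection falls into ['Z(G)], and the strict chain
    [Z(G) < Z(H) < C_H(y2) < H] gives three factors 2. *)
Lemma center_meet_card8 v :
    (forall t, t \in H -> t \notin 'Z(H) -> 'C_G[t] \subset H) ->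
    v \in G -> v \notin H ->
  (8 * #|'Z('C_G[v]) :&: H| <= #|H|)%N.
Proof.
move=> sCH vG nvH.
have sBZ : 'Z('C_G[v]) :&: H \subset 'Z(G).
  apply/subsetP=> t /setIP[tZ tH]; have tG := subsetP sHG t tH.
  have vCt : v \in 'C_G[t].
    by apply: mem_cent1C => //; apply: subsetP (center_sub _) t tZ.
  have [tZH|ntZH] := boolP (t \in 'Z(H)); last first.
    by rewrite (subsetP (sCH t tH ntZH)) in nvH.
  by apply: contraNT nvH => nt; rewrite -(largest_cent1 tZH nt).
have sZZ : 'Z(G) \proper 'Z(H).
  apply/properP; split; last by exists x.
  have sZC : 'Z(G) \subset 'C(G) by apply: subsetIr.
  rewrite subsetI (subset_trans sZC (centS sHG)) andbT subsetI center_sub.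
  by rewrite (subset_trans sZC) //= -cent_set1 centS ?sub1set.
have [y1 [y2 [y1H y2H ny1 ny2 n12]]] := nonabelian_noncentral nabH.
have sZC : 'Z(H) \proper 'C_H[y2].
  apply/properP; split; last by exists y2; rewrite // cent1_id.
  by rewrite setIS // -cent_set1 centS ?sub1set.
have sCprH : 'C_H[y2] \proper H.
  by apply/properP; split; [apply: subsetIl | exists y1; rewrite // inE y1H].
apply: leq_trans (proper_card4 sZC sCprH).
rewrite -[8]/(4 * 2)%N -mulnA leq_mul2l /=.
by apply: leq_trans (proper_card2 sZZ); rewrite leq_mul2l /= subset_leq_card.
Qed.

End LargestCentralizer.

Lemma card_nonabelian_cents x0 :
    x0 \in G -> x0 \notin 'Z(G) -> ~~ abelian 'C_G[x0] ->
  (8 <= #|proper_cents G|)%N /\ (10 <= #|cent_meets G|)%N.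
Proof.
move=> x0G nx0 nab0.
pose P := [pred x | [&& x \in G, x \notin 'Z(G) & ~~ abelian 'C_G[x]]].
have [|x /and3P[xG nx nabH] maxx] := @arg_maxnP _ x0 P (fun x => #|'C_G[x]|).
  by rewrite /= x0G nx0.
have maxH z : z \in G -> z \notin 'Z(G) -> ~~ abelian 'C_G[z] ->
    (#|'C_G[z]| <= #|'C_G[x]|)%N.
  by move=> zG nz nabz; apply: maxx; rewrite /= zG nz.
set H := 'C_G[x]%G in nabH maxH *.
have sHG : H \subset G by apply: subsetIl.
have [u uG nuH] : exists2 u, u \in G & u \notin H.
  by apply/subsetPn; apply: contra nx => sGH;
    rewrite -cent1_eq_center // eqEsubset sHG.
(* The four centralizers are told apart by which of [y1], [y2], [y1 * y2] they contain. *)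
have four y1 y2 (s := [:: 'C_G[x]; 'C_G[y1]; 'C_G[y2]; 'C_G[y1 * y2]]) :
    y1 \in H -> y2 \in H -> y1 \notin 'C_G[y2] ->
  [/\ uniq [seq (y1 \in X, y2 \in X, y1 * y2 \in X) | X : {set gT} <- s],
      {subset s <= proper_cents G} & all (fun X : {set gT} => x \in X) s].
  move=> y1H y2H n12; have y12H := groupM y1H y2H.
  have [y1G y2G y12G] := And3 (subsetP sHG _ y1H) (subsetP sHG _ y2H) (subsetP sHG _ y12H).
  have n21 : y2 \notin 'C_G[y1] by apply: contra n12; apply: mem_cent1C.
  have n1_12 : y1 * y2 \notin 'C_G[y1] by rewrite groupMl ?cent1_id.
  have n2_12 : y1 * y2 \notin 'C_G[y2] by rewrite groupMr ?cent1_id.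
  have n12_1 : y1 \notin 'C_G[y1 * y2] by apply: contra n1_12; apply: mem_cent1C.
  have n12_2 : y2 \notin 'C_G[y1 * y2] by apply: contra n2_12; apply: mem_cent1C.
  split.
  - by rewrite /= y1H y2H y12H !cent1_id // (negPf n12) (negPf n21) (negPf n1_12)
      (negPf n2_12) (negPf n12_1) (negPf n12_2).
  - have nC y z : y \in G -> z \in G -> z \notin 'C_G[y] ->
    'C_G[y] \in proper_cents G.
      move=> yG zG nzy; rewrite mem_proper_cents //.
      by apply: contra nzy; rewrite -cent1_eq_center // => /eqP->.
    apply/allP; rewrite /= (nC _ _ xG uG) // (nC _ _ y1G y2G) // (nC _ _ y2G y1G) //.
    by rewrite (nC _ _ y12G y1G).
  - have xC y : y \in H -> x \in 'C_G[y] by apply: mem_cent1C.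
    by rewrite /= cent1_id // !xC.
have T4 := card_cents_avoiding xG uG nuH (center_meet_card4 xG nabH).
have meets (p : pred {set gT}) :
    (#|[set X in proper_cents G | p X]| <= #|[set X in cent_meets G | p X]|)%N.
  apply/subset_leq_card/subsetP=> X; rewrite !inE => /andP[XC ->].
  by rewrite (subsetP (proper_cents_meets G)).
have [y1 [y2 [y1H y2H _ _ n12]]] := nonabelian_noncentral nabH.
have S4 : (4 <= #|[set X in proper_cents G | x \in X]|)%N.
  have n12C : y1 \notin 'C_G[y2] by rewrite inE negb_and n12 orbT.
  have [Us sC xC] := four y1 y2 y1H y2H n12C.
  apply: (uniq_size_card (map_uniq Us)) => X Xs.
  by rewrite inE sC // (allP xC X Xs).
split; first by rewrite (card_by_mem _ x) (leq_add S4 T4).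
rewrite (card_by_mem _ x).
(* At least four meets contain [x] and four avoid it. If some ['C_G[t]] leaves [H], two further
   meets contain [x], for a total of 6 + 4; otherwise the factor 8 is available and the total is 4 +
   8. *)
have [/existsP[t /and3P[tH ntZ nsCt]]|none] :=
  boolP [exists t, [&& t \in H, t \notin 'Z(H) & ~~ ('C_G[t] \subset H)]].
- suff S6 : (6 <= #|[set X in cent_meets G | x \in X]|)%N.
    exact: (leq_add S6 (leq_trans T4 (meets _))).
  have [y yH nty] : exists2 y, y \in H & t \notin 'C_G[y].
    apply/exists_inP; apply: contraNT ntZ; rewrite negb_exists_in => /forall_inP cH.
    rewrite inE tH; apply/centP=> y yH; apply/cent1P.
    by have := cH y yH; rewrite negbK => /setIP[_].
  have [Us sC xC] := four t y tH yH nty.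
  set s := [:: _; _; _; _] in Us sC xC.
  have tG := subsetP sHG t tH; have yG := subsetP sHG y yH.
  have nyt : y \notin 'C_G[t] by apply: contra nty; apply: mem_cent1C.
  have ntyt : t * y \notin 'C_G[t] by rewrite groupMl ?cent1_id.
  have Cm X : X \in s -> X \in cent_meets G.
    by move/sC; apply: subsetP; apply: proper_cents_meets.
  pose s' := [:: 'C_G[x] :&: 'C_G[t], 'C_G[t] :&: 'C_G[y] & s].
  have Us' : uniq s'.
    (* The last component separates ['C_G[x] :&: 'C_G[t]] from ['C_G[t]], which agree on [t], [y]
       and [t * y]. *)
    pose f (X : {set gT}) := (t \in X, y \in X, t * y \in X, (t \in X) &&
      (X \subset H)).
    have tyG := groupM tG yG; have tyH := groupM tH yH.
    have nyty : t * y \notin 'C_G[y] by rewrite groupMr ?cent1_id.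
    have nty_t : t \notin 'C_G[t * y] by apply: contra ntyt; apply: mem_cent1C.
    have nty_y : y \notin 'C_G[t * y] by apply: contra nyty; apply: mem_cent1C.
    apply: (@map_uniq _ _ f); rewrite /= /f !(in_setI _ 'C_G[x]) !(in_setI _ 'C_G[t]).
    rewrite !cent1_id // tH yH tyH (negPf nty) (negPf nyt) (negPf ntyt) (negPf nyty).
    by rewrite (negPf nty_t) (negPf nty_y) (negPf nsCt) subsetIl subxx.
  apply: (@uniq_size_card _ _ s') => // X.
  rewrite in_cons => /orP[/eqP->|]; last rewrite in_cons => /orP[/eqP->|Xs].
  - rewrite inE sub_cent_meets ?(cent1_neq_center tH nyt yG) //=.
    by rewrite in_setI; apply/andP; split; [apply: cent1_id | apply: mem_cent1C].
  - rewrite inE sub_cent_meets ?(cent1_neq_center tH nyt yG) //=; last first.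
      exact: cent1_neq_center yH nty tG.
    by rewrite in_setI; apply/andP; split; apply: mem_cent1C.
  - by rewrite inE Cm // (allP xC X Xs).
suff T8 : (8 <= #|[set X in proper_cents G | x \notin X]|)%N.
  by apply: leq_trans (leq_add (leq_trans S4 (meets _)) (leq_trans T8 (meets _))).
apply: (card_cents_avoiding xG uG nuH) => v vG nvH.
apply: (center_meet_card8 xG nx nabH maxH) => // t tH ntZ.
by apply: contraNT none => nsCt; apply/existsP; exists t; rewrite tH ntZ.
Qed.

End NonabelianCentralizers.

(** * Numerical bounds for a partition into centralizers *)

Lemma partition_sizes_bound (I : finType) (T : {set I}) (a : I -> nat) N n :
    #|T| = n.+1 -> (0 < n)%N -> (0 < N)%N -> {in T, forall i, 1 < a i}%N ->
    (\sum_(i in T) (a i).-1 = N.-1)%N ->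
    {in T &, forall i j, i != j -> a i * a j <= N}%N ->
  {in T, forall i, a i <= n}%N /\ (N <= n ^ 2)%N.
Proof.
move=> cardT n_gt0 N_gt0 a_gt1 sumT mulT.
have [i1 i1T|] := pickP [in T]; last by move/eq_card0; rewrite cardT.
have [i /= iT maxi] := @arg_maxnP _ i1 [in T] a i1T.
have cardTi : #|T :\ i| = n by have := cardsD1 i T; rewrite cardT iT => -[].
have [j1 j1T|] := pickP [in T :\ i]; last by move/eq_card0; rewrite cardTi; lia.
have [j /= jTi maxj] := @arg_maxnP _ j1 [in T :\ i] a j1T.
have /andP[nji jT] : (j != i) && (j \in T) by rewrite -in_setD1.
(* For the two largest sizes [a i >= a j] this gives [a i * a j <= N <= a i + n * (a j - 1)].
   Cancelling [a j - 1] yields [a i <= n], and then [N <= n + n * (n - 1)]. *)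
have leN : (N.-1 <= (a i).-1 + n * (a j).-1)%N.
  rewrite -sumT (bigD1 i) //= leq_add2l -cardTi -sum_nat_const.
  rewrite (eq_bigl [in T :\ i]); last by move=> k; rewrite !inE andbC.
  by apply: leq_sum => k /maxj; rewrite /geq /=; lia.
have geN := mulT i j iT jT; rewrite eq_sym nji in geN; move/(_ isT) in geN.
have := a_gt1 i iT; have := a_gt1 j jT => aj ai.
have maxij : (a j <= a i)%N := maxi j jT.
have ai_n : (a i <= n)%N by move: leN geN; clear -aj ai N_gt0; nia.
split; last by move: leN; clear - ai_n aj ai maxij N_gt0; nia.
by move=> k /maxi; rewrite /geq /= => /leq_trans->.
Qed.

(* The members of [proper_cents G] of order [d] form a conjugacy class, empty
   unless [d] is a Hall divisor of [N], and of length dividing [N / d]. *)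
Definition count_choices N d : seq nat :=
  if (d %| N) && coprime d (N %/ d) then
    [seq c <- iota 0 9 | (c == 0) || (c %| N %/ d)] else [:: 0].

(** Here [c d] stands for the number of centralizers of order [d]; the two sums count the eight
    centralizers and the nonidentity elements of the group. The finitely many cases are checked by
    computation. *)
Lemma orbit_counts N (c : nat -> nat) :
    (1 < N <= 49)%N -> (forall d, 1 < d < 8 -> c d \in count_choices N d)%N ->
    (c 2 + c 3 + c 4 + c 5 + c 6 + c 7 = 8)%N ->
    (c 2 + c 3 * 2 + c 4 * 3 + c 5 * 4 + c 6 * 5 + c 7 * 6 = N.-1)%N ->
  c 7 = 1%N.
Proof.
move=> Nbnd cP sum8 sumN; pose C := count_choices.
have : all (fun N => all (fun c2 => all (fun c3 => all (fun c4 => all (fun c5 =>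
  all (fun c6 => all (fun c7 => [&& c2 + c3 + c4 + c5 + c6 + c7 == 8 &
    c2 + c3 * 2 + c4 * 3 + c5 * 4 + c6 * 5 + c7 * 6 == N.-1] ==> (c7 == 1)) (C N 7))
    (C N 6)) (C N 5)) (C N 4)) (C N 3)) (C N 2))%N (iota 2 48).
  by vm_compute.
move/allP/(_ N); rewrite mem_iota => /(_ Nbnd).
do 6![move/allP/(_ _ (cP _ _)); move/(_ isT)].
by rewrite sum8 sumN !eqxx => /eqP.
Qed.

(** * Centerless groups partitioned by abelian centralizers *)

Section TrivialCenter.

Variables (gT : finGroupType) (G : {group gT}).
Hypotheses (Z1 : 'Z(G) = 1) (abC : abelian_cents G).
Implicit Types (x y z : gT) (X Y : {set gT}).

Lemma cent1_eq x y : x \in G -> x != 1 -> y \in 'C_G[x] -> y != 1 ->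
  'C_G[y] = 'C_G[x].
Proof. by move=> xG nx cxy ny; apply: abelian_cents_eq; rewrite // Z1 inE. Qed.

Lemma proper_centP X :
  reflect (exists x, [/\ x \in G, x != 1 & X = 'C_G[x]]) (X \in proper_cents G).
Proof.
apply: (iffP (proper_centsP G X)); rewrite Z1.
  by case=> x /setDP[xG nx] ->; exists x; rewrite inE in nx.
by case=> x [xG nx ->]; exists x; rewrite // !inE nx.
Qed.

Lemma sum_card_proper_cents :
  (\sum_(X in proper_cents G) #|X|.-1 = #|G|.-1)%N.
Proof.
have -> : #|G|.-1 = #|G^#| by rewrite (cardsD1 1 G) group1.
have toC x : x \in G^# -> 'C_G[x] \in proper_cents G.
  by case/setD1P=> nx xG; apply/proper_centP; exists x.
rewrite -sum1_card (partition_big _ _ toC); apply: eq_bigr =>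
  _ /proper_centP[x [xG nx ->]].
rewrite sum1_card (cardD1 1) group1 /=; apply: eq_card => y.
rewrite inE /= [RHS]inE /= in_setD1.
apply/andP/andP=> [[ny cxy]|[/andP[ny yG] /eqP E]].
  by rewrite ny (cent1_eq xG) // eqxx; have [-> _] := setIP cxy.
by rewrite -E cent1_id.
Qed.

Lemma proper_cents_TI X Y :
  X \in proper_cents G -> Y \in proper_cents G -> X != Y -> X :&: Y = 1.
Proof.
case/proper_centP=> x [xG nx ->] /proper_centP[y [yG ny ->]] nxy.
by rewrite (abelian_cents_meet abC xG _ yG) ?Z1 ?inE.
Qed.

Lemma card_proper_cents_mul X Y :
  X \in proper_cents G -> Y \in proper_cents G -> X != Y -> (#|X| * #|Y| <= #|G|)%N.
Proof.
move=> XC YC /(proper_cents_TI XC YC).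
case/proper_centP: XC => x [xG nx ->]; case/proper_centP: YC => y [yG ny ->] TI.
by rewrite -TI_cardMg // subset_leq_card // mul_subG ?subsetIl.
Qed.

(** Let [S] be a Sylow subgroup of [G] above [P]. A nontrivial [z] in ['Z(S)] commutes with a
    nontrivial element of [P], whose centralizer is ['C_G[x]]; so [S] lies in ['C_G[z] =
    'C_G[x]]. *)
Lemma proper_cent_Sylow p x (P : {group gT}) : x \in G -> x != 1 ->
  p.-Sylow('C_G[x]) P -> P :!=: 1 -> p.-Sylow(G) P.
Proof.
move=> xG nx sylP ntP; have [sPX pP _] := and3P sylP.
have [S sylS sPS] := Sylow_superset (subset_trans sPX (subsetIl _ _)) pP.
have [sSG pS _] := and3P sylS.
have [y yP ny] := trivgPn _ ntP.
have ntS : S :!=: 1 by apply: contraNneq ntP => S1; rewrite -subG1 -S1.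
have /trivgPn[z /setIP[zS czS] nz] : 'Z(S) != 1 by rewrite (center_nil_eq1 (pgroup_nil pS)).
have EX : 'C_G[y] = 'C_G[x] by apply: cent1_eq ny => //; apply: (subsetP sPX).
have zX : z \in 'C_G[x].
  rewrite -EX inE (subsetP sSG) //.
  by apply/cent1P; apply: (centP czS); apply: (subsetP sPS).
suff sSX : S \subset 'C_G[x].
  by rewrite -(_ : S :=: P) //; apply/eqP; rewrite eqEsubset sPS andbT
     -(sub_pHall sylP pS sPS sSX).
by rewrite -(cent1_eq xG nx zX nz) subsetI sSG sub_cent1.
Qed.

Lemma proper_cent_gt1 X : X \in proper_cents G -> (1 < #|X|)%N.
Proof.
case/proper_centP=> x [xG nx ->]; rewrite cardG_gt1.
by apply/trivgPn; exists x; rewrite ?cent1_id.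
Qed.

Lemma pdiv_Sylow_neq1 (X P : {group gT}) :
  (1 < #|X|)%N -> (pdiv #|X|).-Sylow(X) P -> P :!=: 1.
Proof.
move=> X_gt1 sylP; rewrite -cardG_gt1 (card_Hall sylP) p_part_gt1.
by rewrite pi_pdiv.
Qed.

Lemma proper_cent_Hall X : X \in proper_cents G -> coprime #|X| (#|G| %/ #|X|).
Proof.
case/proper_centP=> x [xG nx ->]; rewrite divgS ?subsetIl //.
rewrite coprime_has_primes ?cardG_gt0 ?indexg_gt0 //; apply/hasPn=> p.
rewrite !mem_primes => /and3P[p_pr _ pG]; rewrite p_pr cardG_gt0 /=.
apply/negP=> pX; have [P sylP] := Sylow_exists p 'C_G[x].
have ntP : P :!=: 1.
  by rewrite -cardG_gt1 (card_Hall sylP) p_part_gt1 mem_primes p_pr cardG_gt0.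
have [_ _] := and3P (proper_cent_Sylow xG nx sylP ntP).
rewrite p'natE // => /negP[]; apply: dvdn_trans pG _.
by rewrite -(Lagrange_index (subsetIl G 'C[x]) (pHall_sub sylP)) dvdn_mulr.
Qed.

(** For a prime dividing the common order, Sylow subgroups of [X] and [Y] are Sylow in [G], hence
    conjugate, and any nontrivial element of a member of [proper_cents G] determines it. *)
Lemma proper_cents_conj X Y : X \in proper_cents G -> Y \in proper_cents G ->
  #|X| = #|Y| -> exists2 g, g \in G & Y = X :^ g.
Proof.
move=> XC YC; have := proper_cent_gt1 XC; have := proper_cent_gt1 YC.
case/proper_centP: XC => x [xG nx ->]; case/proper_centP: YC => y [yG ny ->].
move=> Y_gt1 X_gt1 eqXY.
have [P sylP] := Sylow_exists (pdiv #|'C_G[x]|) 'C_G[x].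
have [Q sylQ] := Sylow_exists (pdiv #|'C_G[y]|) 'C_G[y].
have ntP := pdiv_Sylow_neq1 X_gt1 sylP; have ntQ := pdiv_Sylow_neq1 Y_gt1 sylQ.
have sylPG := proper_cent_Sylow xG nx sylP ntP.
have := proper_cent_Sylow yG ny sylQ ntQ; rewrite -eqXY => sylQG.
have [g gG EQ] := Sylow_trans sylPG sylQG.
have [q qQ nq] := trivgPn _ ntQ; exists g => //.
have xgG : x ^ g \in G by rewrite groupJ.
have EX : 'C_G[x] :^ g = 'C_G[x ^ g] by rewrite conjIg conjGid // cent1J.
have <- : 'C_G[q] = 'C_G[y] by apply: cent1_eq;
  rewrite // (subsetP (pHall_sub sylQ)).
have nxg : x ^ g != 1 by rewrite conjg_eq1.
rewrite EX; apply: cent1_eq => //; rewrite -EX; move: qQ; rewrite EQ.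
by apply: subsetP; rewrite conjSg (pHall_sub sylP).
Qed.

Lemma proper_cents_orbit X : X \in proper_cents G ->
  [set Y in proper_cents G | #|Y| == #|X|] = X :^: G.
Proof.
move=> XC; apply/setP=> Y; rewrite inE; apply/andP/imsetP=> [[YC /eqP E]|[g gG ->]].
  exact: proper_cents_conj.
rewrite cardJg eqxx; split=> //; case/proper_centP: XC => x [xG nx ->].
by apply/proper_centP; exists (x ^ g); rewrite groupJ // conjg_eq1 conjIg conjGid // cent1J.
Qed.

(** The length of the conjugacy class is the index of the normalizer of [X], which contains the
    abelian group [X]. *)
Lemma card_proper_cents_orbit X : X \in proper_cents G ->
  (#|[set Y in proper_cents G | #|Y| == #|X| ]| %| #|G| %/ #|X|)%N.
Proof.
move=> XC; rewrite proper_cents_orbit // card_conjugates.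
case/proper_centP: XC => x [xG nx ->]; rewrite divgS ?subsetIl //.
by rewrite indexgS // subsetI subsetIl normG.
Qed.

End TrivialCenter.

(** * Frobenius groups with kernel of order 7 *)

(* Equivalently, a Frobenius group with kernel of order 7. *)
Definition frob7 (gT : finGroupType) (G : {group gT}) :=
  exists N : {group gT}, [/\ N <| G, #|N| = 7, 'C_G(N) = N & N :!=: G].

Lemma eight_cents_frob7 (gT : finGroupType) (G : {group gT}) :
    'Z(G) = 1 -> abelian_cents G -> #|proper_cents G| = 8 -> frob7 G.
Proof.
move=> Z1 abC card8; pose T := proper_cents G; pose N := #|G|.
have N_gt1 : (1 < N)%N.
  rewrite ltnNge; apply/negP=> N_le1; have T0 : T = set0.
    apply/setP=> X; rewrite inE; apply/negP=> XC.
    case/proper_centP: (XC) => // x [xG nx _].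
    by rewrite (card_le1_trivg N_le1) inE (negPf nx) in xG.
  by move: card8; rewrite -/T T0 cards0.
have T_gt1 : {in T, forall X : {set gT}, 1 < #|X|}%N.
  by move=> X; apply: proper_cent_gt1.
have T_mul : {in T &, forall X Y : {set gT}, X != Y -> #|X| * #|Y| <= N}%N.
  by move=> X Y; apply: card_proper_cents_mul.
have [le7 le49] := partition_sizes_bound card8 isT (ltnW N_gt1) T_gt1
  (sum_card_proper_cents Z1 abC) T_mul.
pose c d := #|[set X in T | #|X| == d]|.
(* Regrouping by order; orders are at most 7, so [inord] into ['I_8] is faithful. *)
have sumf (f : nat -> nat) : (\sum_(X in T) f #|X| = \sum_(d < 8) c d * f d)%N.
  rewrite (partition_big (fun X : {set gT} => inord #|X| : 'I_8) predT) //=.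
  apply: eq_bigr => d _; rewrite -sum_nat_const; apply: eq_big => X.
    rewrite inE; case XT: (X \in T) => //=.
    by rewrite -val_eqE /= inordK // ltnS le7.
  by case/andP=> XT /eqP <-; rewrite inordK // ltnS le7.
have c01 d : (d < 2)%N -> c d = 0%N.
  move=> d2; apply/eqP; rewrite cards_eq0; apply/eqP/setP=> X; rewrite !inE.
  apply/negP=> /andP[XT /eqP E]; have := proper_cent_gt1 Z1 XT.
  by rewrite E ltnNge -ltnS d2.
have c7 : c 7 = 1%N.
  apply: (@orbit_counts N).
  - by rewrite N_gt1.
  - move=> d /andP[d_gt1 d_lt8]; rewrite /count_choices.
    have c_le8 : (c d < 9)%N.
      by rewrite ltnS -card8 subset_leq_card //; apply/subsetP=> X; rewrite inE =>
        /andP[].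
    have [c0|] := posnP (c d).
      by case: ifP; rewrite c0 ?mem_filter ?inE.
    case/card_gt0P=> X; rewrite inE => /andP[XT /eqP Xd].
    have := proper_cent_Hall Z1 abC XT; have := card_proper_cents_orbit Z1 abC XT.
    rewrite Xd -/(c d) -/N => dvc ->; rewrite andbT.
    have -> : (d %| N)%N.
      by rewrite -Xd; case/(proper_centP Z1): XT => x [xG _ ->];
        rewrite cardSg ?subsetIl.
    by rewrite mem_filter dvc orbT mem_iota.
  - have := sumf (fun=> 1%N); rewrite sum1_card card8 !big_ord_recl big_ord0 /=.
    by rewrite /bump /= !add1n !(c01 0%N, c01 1%N) //; clear; lia.
  - have := sumf predn; rewrite (sum_card_proper_cents Z1 abC) -/N !big_ord_recl big_ord0 /=.
    by rewrite /bump /= !add1n !(c01 0%N, c01 1%N) //; clear; lia.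
(* The only member of order 7 is alone in its conjugacy class, hence normal. *)
have /card_gt0P[X] : (0 < c 7)%N by rewrite c7.
rewrite inE => /andP[XT /eqP X7].
have nX : G \subset 'N(X).
  have : #|X :^: G| = 1%N by rewrite -(proper_cents_orbit Z1 abC XT) X7.
  rewrite card_conjugates => /eqP; rewrite indexg_eq1 => /subset_trans->//.
  exact: subsetIr.
case/(proper_centP Z1): XT X7 nX => x [xG nx EX]; rewrite EX => X7 nX.
have nxZ : x \notin 'Z(G) by rewrite Z1 inE.
exists 'C_G[x]%G; split=> //.
- by rewrite /normal subsetIl.
- apply/eqP; rewrite eqEsubset; apply/andP; split.
    apply: setIS; apply/subsetP=> y /centP cy; apply/cent1P; apply: cy.
    exact: cent1_id.
  by rewrite subsetI subsetIl; apply: abC.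
- by rewrite cent1_eq_center.
Qed.

Section Frob7.

Variables (gT : finGroupType) (G N : {group gT}).
Hypotheses (nsNG : N <| G) (cardN : #|N| = 7) (cNN : 'C_G(N) = N) (neqNG : N :!=: G).
Implicit Types (x y n g : gT).

Let sNG : N \subset G := normal_sub nsNG.

Lemma frob7_cent1_kernel n : n \in N -> n != 1 -> 'C_G[n] = N.
Proof.
move=> nN nn; have sn : <[n]> \subset N by rewrite cycle_subG.
have En : <[n]> = N.
  apply/eqP; rewrite eqEcard sn; have := cardSg sn; rewrite cardN.
  have /primeP[_ dv7] : prime 7 by [].
  case/dv7/pred2P=> [o1|-> //].
  by move: nn; rewrite -order_eq1 /order o1.
by rewrite -cent_cycle En.
Qed.

Lemma frob7_center : 'Z(G) = 1.
Proof.
apply/eqP; apply: contraNT neqNG => /trivgPn[z zZ nz].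
have zG := subsetP (center_sub G) z zZ.
have zN : z \in N.
  rewrite -cNN inE zG; have /setIP[_] := zZ.
  by apply: subsetP; apply: centS.
by rewrite -(frob7_cent1_kernel zN nz) cent1_eq_center.
Qed.

(** Conjugation on [N] has kernel ['C_G(N) = N], so [G / N] embeds in [Aut N], which is cyclic of
    order 6. *)
Lemma frob7_cyclic_quotient : cyclic (G / N) /\ #|G / N| %| 6.
Proof.
have nNG := normal_norm nsNG; pose f := conj_aut N.
have Ek : 'ker_G f = N by rewrite ker_conj_aut.
have [h injh imh] := first_isom_loc f nNG.
have cardAut : #|Aut N| = 6 by rewrite card_Aut_cyclic ?cardN // prime_cyclic ?cardN.
have Eh := imh G (subxx _); rewrite /= Ek in h injh imh Eh.
have pN : prime #|N| by rewrite cardN.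
have sA : f @* G \subset Aut N by apply: Aut_conj_aut.
rewrite -(injm_cyclic injh (subxx _)) -(card_injm injh (subxx _)) /= Eh -cardAut.
by rewrite cardSg // (cyclicS sA) // Aut_prime_cyclic.
Qed.

Lemma frob7_index : #|G| = (7 * #|G / N|)%N /\ #|G / N| \in [:: 2; 3; 6].
Proof.
have [_ d6] := frob7_cyclic_quotient.
have EG : #|G| = (7 * #|G / N|)%N.
  by rewrite card_quotient ?normal_norm // -cardN Lagrange.
split=> //; move: d6; rewrite dvdn_divisors // in_cons => /predU1P[k1|//].
by move: neqNG; rewrite eqEcard sNG EG k1 cardN.
Qed.

Lemma frob7_der : [~: G, G] \subset N.
Proof.
have [/cyclic_abelian abGN _] := frob7_cyclic_quotient.
by rewrite -derg1 der1_min ?normal_norm.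
Qed.

Lemma frob7_cent1_TI g : g \in G -> g \notin N -> N :&: 'C_G[g] = 1.
Proof.
move=> gG ngN; apply/trivgP/subsetP=> n /setIP[nN cgn]; rewrite inE.
apply: contraNT ngN => nn; rewrite -(frob7_cent1_kernel nN nn).
exact: mem_cent1C.
Qed.

(** For [x] outside [N], commutators of elements of ['C_G[x]] lie both in [N] and in ['C_G[x]],
    which meet trivially. *)
Lemma frob7_abelian_cents : abelian_cents G.
Proof.
move=> x xG; rewrite frob7_center inE => nx.
have [xN|nxN] := boolP (x \in N).
  by rewrite frob7_cent1_kernel // cyclic_abelian // prime_cyclic // cardN.
apply/commG1P/trivgP; rewrite -(frob7_cent1_TI xG nxN) subsetI commg_subr normG andbT.
by apply: subset_trans frob7_der; apply: commgSS; apply: subsetIl.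
Qed.

(** The upper bound holds because ['C_G[g]] meets [N] trivially; the lower one because [G / N] is
    abelian, so the class of [g] lies in a coset of [N]. *)
Lemma frob7_card_cent1 g : g \in G -> g \notin N -> #|'C_G[g]| = #|G / N|.
Proof.
move=> gG ngN; have [EG _] := frob7_index.
have leCG : (7 * #|'C_G[g]| <= #|G|)%N.
  rewrite -cardN -TI_cardMg ?frob7_cent1_TI // subset_leq_card //.
  by rewrite mul_subG ?subsetIl.
have leGC : (#|G| <= 7 * #|'C_G[g]|)%N.
  rewrite -(Lagrange (subsetIl G 'C[g])) mulnC leq_mul2r index_cent1; apply/orP;
    right.
  rewrite -cardN -(card_lcoset N g); apply/subset_leq_card/subsetP=>
    _ /imsetP[y yG ->].
  by rewrite mem_lcoset -commgEl (subsetP frob7_der) ?mem_commg.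
by move: leCG leGC; rewrite EG; lia.
Qed.

Lemma frob7_card_cents : #|proper_cents G| = 8.
Proof.
have Z1 := frob7_center; have [EG k236] := frob7_index.
have NC : (N : {set gT}) \in proper_cents G.
  have /trivgPn[n nN nn] : N :!=: 1 by rewrite -cardG_gt1 cardN.
  apply/(proper_centP Z1); exists n; rewrite (subsetP sNG) //; split=> //.
  by rewrite frob7_cent1_kernel.
have := sum_card_proper_cents Z1 frob7_abelian_cents.
rewrite (big_setD1 (N : {set gT})) //= (eq_bigr (fun=> #|G / N|.-1)); last first.
  move=> X; rewrite in_setD1 => /andP[nXN /(proper_centP Z1)[x [xG nx EX]]].
  rewrite EX frob7_card_cent1 //; apply: contraNN nXN => xN.
  by rewrite EX frob7_cent1_kernel.
(* With [k] the index of [N] and [m] the number of members other than [N], counting nonidentity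
   elements gives [7 k - 1 = 6 + m (k - 1)], so [m = 7]. *)
rewrite sum_nat_const cardN EG (cardsD1 (N : {set gT}) (proper_cents G)) NC.
move: #|_ :\ _| => m; move: k236; rewrite !inE.
by case/or3P=> /eqP->; lia.
Qed.

(* Conjugation by a generator [c] of a complement raises [n] to the [b]-th
   power, with [b] of order [k] modulo 7; replacing [c] by a suitable power
   normalizes [b]. *)
Definition frob7_exponent k := if k == 2 then 6 else if k == 3 then 2 else 3.

Lemma frob7_gens : exists n c, [/\ <[n]> ><| <[c]> = G, #[n] = 7,
  #[c] = #|G / N| & n ^ c = n ^+ frob7_exponent #|G / N|].
Proof.
have [EG k236] := frob7_index; have [cycGN d6] := frob7_cyclic_quotient.
set k := #|G / N| in EG k236 d6 *.
have hallN : Hall G N.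
  rewrite /Hall sNG -card_quotient ?normal_norm // -/k cardN.
  by apply: coprime_dvdr d6 _.
have /splitsP[K /complP[TI EK]] := SchurZassenhaus_split hallN nsNG.
have nNK : K \subset 'N(N).
  by rewrite (subset_trans _ (normal_norm nsNG)) // -EK mulG_subr.
have defG : N ><| K = G by rewrite sdprodE.
have isoK := sdprod_isog defG.
have /cyclicP[c EKc] : cyclic K by rewrite (isog_cyclic isoK).
have /cyclicP[n EN] : cyclic N by rewrite prime_cyclic // cardN.
have cardc : #[c] = k by rewrite /order -EKc (card_isog isoK).
have cardn : #[n] = 7 by rewrite /order -EN.
have cK : c \in K by rewrite EKc cycle_id.
have sKG : K \subset G by rewrite -EK mulG_subr.
have [b b7 Eb] : {b | (b < #[n])%N & n ^ c = n ^+ b}.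
  apply: cyclePmin; rewrite -EN memJ_norm ?EN ?cycle_id //.
  by rewrite -EN (subsetP nNK).
have Ebj j : n ^ (c ^+ j) = n ^+ (b ^ j).
  elim: j => [|j IH]; first by rewrite expg0 conjg1.
  by rewrite expgSr conjgM IH conjXg Eb -expgM -expnS.
(* The complement acts faithfully because [N] is self-centralizing, so [b] has order exactly [k]
   modulo 7. *)
have ordb j : (b ^ j == 1 %[mod 7]) = (k %| j).
  rewrite -cardn -eq_expg_mod_order -Ebj expg1 -cardc order_dvdn.
  rewrite (sameP eqP conjg_fixP) (sameP commgP cent1P) cent1C.
  apply/idP/eqP=> [cn|->]; last exact: group1.
  apply/set1P; have cjK : c ^+ j \in K by rewrite groupX.
  rewrite -[[set 1]]TI inE cjK andbT -cNN inE (subsetP sKG) //=.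
  by rewrite EN cent_cycle.
have [j] : exists j, coprime k j && (b ^ j == frob7_exponent k %[mod 7]).
  (* Finite check: each [b] of order [k] modulo 7 has the prescribed residue among its powers, with
     an exponent coprime to [k], so that [c ^+ j] still generates the complement. *)
  have : all (fun k => all (fun b => all (fun j => (b ^ j == 1 %[mod 7]) == (k %| j))
      (iota 1 6) ==> has (fun j => coprime k j &&
        (b ^ j == frob7_exponent k %[mod 7]))
      (iota 0 6)) (iota 0 7)) [:: 2; 3; 6] by vm_compute.
  rewrite cardn in b7; move/allP/(_ k k236)/allP/(_ b); rewrite mem_iota => /(_ b7).
  move/implyP/(_ _)/hasP=> [|j _ jP]; last by exists j.
  by apply/allP=> j _; rewrite ordb.
case/andP=> cop /eqP Ej; exists n, (c ^+ j).
have Ecj : <[c ^+ j]> = <[c]>.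
  by apply/esym/eqP; have := generator_coprime c j; rewrite cardc cop.
have ocj : #[c ^+ j] = k by rewrite /order Ecj.
rewrite Ecj -EN -EKc defG ocj; split=> //.
by rewrite Ebj; apply/eqP; rewrite eq_expg_mod_order cardn Ej.
Qed.

End Frob7.

(** * Identification with the named groups *)

Lemma frob7_isog (gT rT : finGroupType) (G : {group gT}) (H : {group rT}) :
  frob7 G -> frob7 H -> #|G| = #|H| -> G \isog H.
Proof.
case=> N [nsNG oN cN neN] [M [nsMH oM cM neM]] eqGH.
have [EG _] := frob7_index nsNG oN cN neN; have [EH _] := frob7_index nsMH oM cM neM.
have eqk : #|G / N| = #|H / M| by move: EG; rewrite eqGH EH; lia.
have [n [c [defG on oc nc]]] := frob7_gens nsNG oN cN neN.
have [m [d [defH om od md]]] := frob7_gens nsMH oM cM neM.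
rewrite eqk in oc nc; set a := frob7_exponent _ in nc md.
have mn : #[m] %| #[n] by rewrite on om.
have dc : #[d] %| #[c] by rewrite oc od.
(* Equal orders give equal indices, hence the same exponent [a]; so [n] to [m] and [c] to [d]
   respect the two actions and glue to a map of semidirect products. *)
have actf : {in <[n]> & <[c]>, morph_act 'J 'J (eltm mn) (eltm dc)}.
  move=> _ _ /cycleP[i ->] /cycleP[j ->] /=.
  have powJ (T : finGroupType) (u v : T) : u ^ v = u ^+ a ->
      (u ^+ i) ^ (v ^+ j) = u ^+ (a ^ j * i).
    move=> uv; rewrite conjXg expgM; congr (_ ^+ i).
    elim: (j) => [|l IH]; first by rewrite expg0 conjg1.
    by rewrite expgSr conjgM IH conjXg uv -expgM -expnS.
  by rewrite (powJ _ n c) // !eltmE (powJ _ m d).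
pose f := sdprodm defG actf.
have [_ _ _ TI] := sdprodP defH.
have [_ EmH _ _] := sdprodP defH.
apply/isogP; exists [morphism of f].
  rewrite injm_sdprodm !injm_eltm on om oc od !dvdnn /=.
  by rewrite !im_eltm TI.
by rewrite im_sdprodm !im_eltm.
Qed.

Lemma frob7_morphim (gT rT : finGroupType) (G : {group gT}) (H : {group rT}) :
  G \isog H -> frob7 G -> frob7 H.
Proof.
case/isogP=> f injf EH [N [nsNG oN cN neN]]; have sNG := normal_sub nsNG.
exists (f @* N)%G; split; rewrite /= -?EH.
- exact: morphim_normal.
- by rewrite card_injm.
- by rewrite -{2}cN injm_subcent.
- by apply: contraNneq neN => E; rewrite eqEcard sNG -(card_injm injf sNG) E card_injm //=.
Qed.

(** The number of Sylow 7-subgroups divides [7 p] and is 1 modulo 7, hence is 1. If ['C_G(N)] were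
    larger than [N] it would be [G], and a central [N] with quotient of prime order makes [G]
    abelian. *)
Lemma nonabelian7p_frob7 (gT : finGroupType) (G : {group gT}) p :
  (p \in [:: 2; 3])%N -> #|G| = (7 * p)%N -> ~~ abelian G -> frob7 G.
Proof.
move=> p23 oG nabG; have [N sylN] := Sylow_exists 7 G.
have p_pr : prime p by move: p23; rewrite !inE => /pred2P[]->.
have syl1 : #|'Syl_7(G)| = 1%N.
  have := card_Syl_dvd 7 G; have := @card_Syl_mod 7 _ G isT; rewrite oG.
  move: #|'Syl_7(G)| p23 => m p23 m1; rewrite dvdn_divisors ?muln_gt0 ?prime_gt0 //.
  by move: p23 m1; rewrite !inE => /pred2P[]->; rewrite !inE => + /or4P[]/eqP E;
    rewrite E.
have sNG := pHall_sub sylN.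
have nsNG : N <| G.
  rewrite /normal sNG; have /eqP := card_Syl sylN.
  rewrite syl1 eq_sym indexg_eq1 => /subset_trans->//; exact: subsetIr.
have oN : #|N| = 7.
  by rewrite (card_Hall sylN) oG p_part; move: p23; rewrite !inE => /pred2P[]->.
have iN : #|G : N| = p by rewrite -divgS // oG oN mulKn.
have abN : abelian N by rewrite cyclic_abelian // prime_cyclic ?oN.
have sNC : N \subset 'C_G(N) by rewrite subsetI sNG.
exists N; split=> //.
  apply/eqP; rewrite eqEsubset sNC andbT.
  have := Lagrange_index (subsetIl G 'C(N)) sNC; rewrite iN => Ep.
  have : #|'C_G(N) : N| %| p by rewrite -Ep dvdn_mull.
  case/primeP: (p_pr) => _ /[apply] /pred2P[/eqP|Ep']; first by rewrite indexg_eq1.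
  case/negP: nabG; apply: (@cyclic_factor_abelian _ N).
    rewrite subsetI sNG centsC; apply: subset_trans (subsetIr G _).
    rewrite -indexg_eq1 -(eqn_pmul2r (prime_gt0 p_pr)) mul1n; apply/eqP.
    by rewrite -{1}Ep'.
  by rewrite prime_cyclic // card_quotient ?normal_norm // iN.
by apply: contraNneq nabG => <-.
Qed.

Lemma frob7_nonabelian (gT : finGroupType) (G : {group gT}) : frob7 G ->
  ~~ abelian G.
Proof.
case=> N [nsNG oN cN neN]; apply: contra (neN) => abG.
have /setIidPl := abG; rewrite -/('Z(G)) (frob7_center nsNG oN cN neN) => G1.
have := cardSg (normal_sub nsNG); rewrite -G1 oN cards1; done.
Qed.

Lemma card_dihedral14 : #|[set: 'D_14]| = 14.
Proof. exact: (@card_dihedral 7). Qed.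

Lemma frob7_dihedral : frob7 [set: 'D_14].
Proof.
apply: (@nonabelian7p_frob7 _ _ 2); rewrite ?card_dihedral14 //.
apply/negP=> abD.
have := isoGrp_hom (@Grp_dihedral 7 isT).
case/existsP=> -[x y] /=; rewrite !xpair_eqE =>
  /and4P[/eqP defD /eqP x7 /eqP y2 /eqP xy].
have cxy : commute x y.
  have : x \in 'C([set: 'D_14]) by apply: (subsetP abD); rewrite inE.
  by move/centP; apply; rewrite inE.
(* Commuting with [y], [x] equals its inverse; together with [x ^+ 7 = 1] this kills [x], and [y]
   alone generates at most 2 elements. *)
have x1 : x = 1.
  have x_x : x = x^-1 by rewrite -xy; apply/esym/conjg_fixP/commgP.
  have x2 : x ^+ 2 = 1 by rewrite expgS expg1 {1}x_x mulVg.
  by move: x7; rewrite -[7%N]/(2 * 3 + 1)%N expgD expgM x2 expg1n mul1g expg1.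
have : #[y] %| 2 by rewrite order_dvdn y2.
move: card_dihedral14; rewrite -defD x1 cycle1 joing1G /order /= => ->.
by [].
Qed.

Lemma card_Hol : #|[set: Hol [set: 'Z_7]%G]| = 42.
Proof.
have /sdprod_card <- := sdprod_sdpair [Aut [set: 'Z_7]].
rewrite (card_injm (injm_sdpair1 _)) // (card_injm (injm_sdpair2 _)) //=.
by rewrite card_Aut_cyclic ?prime_cyclic // cardsT card_ord.
Qed.

Lemma frob7_Hol : frob7 [set: Hol [set: 'Z_7]%G].
Proof.
pose to := aut_groupAction [set: 'Z_7]%G; have defH := sdprod_sdpair to.
have [nsNH _ defNK nNK TI] := sdprod_context defH.
exists (sdpair1 to @* [set: 'Z_7])%G; split=> //.
- by rewrite (card_injm (injm_sdpair1 _)) // cardsT card_ord.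
- set N := (sdpair1 to @* _)%G in nsNH *; set H := [set: _]%G in nsNH *.
  have abN : abelian N.
    rewrite morphim_abelian // cyclic_abelian // prime_cyclic // cardsT card_ord //.
  apply/eqP; rewrite eqEsubset subsetI (normal_sub nsNH) [in X in _ && X]/=;
    apply/andP; split; last exact: abN.
  (* Split [u] into an automorphism [a] and an element of [N]. As [N] is abelian, the image of [a]
     centralizes [N] too, so [a] fixes every point. *)
  apply/subsetP=> u /setIP[_ cNu]; pose a := (val u).1; pose x := (val u).2.
  have aA : a \in Aut [set: 'Z_7] by have := valP u; rewrite inE => /andP[].
  have Eu : u = sdpair2 to a * sdpair1 to x := sdpairE u.
  have xN : sdpair1 to x \in N by apply: mem_morphim; rewrite ?inE.
  have cNa : sdpair2 to a \in 'C(N).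
    by rewrite -(groupMr _ (subsetP abN _ xN)) -Eu.
  suff a1 : a = 1 by rewrite Eu a1 morph1 mul1g.
  apply/permP=> y; rewrite perm1.
  have yR : y \in [set: 'Z_7]%G by rewrite inE.
  apply: (injmP (injm_sdpair1 to)); rewrite ?inE //.
  have := sdpair_act to yR aA.
  rewrite /= => ->; apply/conjg_fixP/commgP/esym.
  by apply: (centP cNa); apply: mem_morphim.
- apply/eqP=> /(congr1 (fun A : {set Hol [set: 'Z_7]%G} => #|A|)) /=;
  rewrite card_Hol.
  by rewrite (card_injm (injm_sdpair1 _)) // cardsT card_ord.
Qed.

Lemma frob7P (gT : finGroupType) (G : {group gT}) :
  frob7 G <-> [\/ G \isog 'D_14, G \isog [set: Hol [set: 'Z_7]%G]
       | ~~ abelian G /\ #|G| = 21].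
Proof.
split=> [fG|[isoG|isoG|[nabG oG]]]; last exact: nonabelian7p_frob7 (_ : 3 \in _) oG nabG.
- case: (fG) => N [nsNG oN cN neN].
  have [oG] := frob7_index nsNG oN cN neN; rewrite !inE => /or3P[]/eqP k;
    rewrite k in oG.
  + by constructor 1; apply: (frob7_isog fG frob7_dihedral);
    rewrite oG card_dihedral14.
  + by constructor 3; rewrite frob7_nonabelian.
  + by constructor 2; apply: (frob7_isog fG frob7_Hol); rewrite oG card_Hol.
- by apply: frob7_morphim frob7_dihedral; rewrite isog_sym.
- by apply: frob7_morphim frob7_Hol; rewrite isog_sym.
Qed.

(** * The criterion for nine two-element centralizers *)

Lemma abelian_cents_or_many (gT : finGroupType) (G : {group gT}) :
  abelian_cents G \/ (8 <= #|proper_cents G|)%N /\ (10 <= #|cent_meets G|)%N.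
Proof.
have [/forall_inP abC|] :=
  boolP [forall x in G, (x \notin 'Z(G)) ==> abelian 'C_G[x]].
  by left=> x xG; apply/implyP/abC.
rewrite negb_forall_in => /exists_inP[x xG]; rewrite negb_imply => /andP[nx nabx].
by right; apply: card_nonabelian_cents xG nx nabx.
Qed.

Lemma abelian_no_cents (gT : finGroupType) (G : {group gT}) :
  abelian G -> #|proper_cents G| = 0%N /\ #|cent_meets G| = 0%N.
Proof.
rewrite /proper_cents /cent_meets => /center_idP->; rewrite setDv imset0 cards0.
split=> //; apply/eqP; rewrite cards_eq0; apply/eqP/setP=> X; rewrite [RHS]inE.
by apply/imset2P=> -[x y]; rewrite inE.
Qed.

(** A nonabelian centralizer already produces ten meets. Otherwise, for nonabelian [G], the total is
    [#|proper_cents G|] plus 1 or 2, according to whether the center is trivial, which leaves the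
    values 8 and 7. *)
Lemma two_nine_centralizerP (gT : finGroupType) (G : {group gT}) :
  two_n_centralizer G 9 <->
  frob7 G \/ 'Z(G) <> 1 /\ #|proper_cents G| = 7.
Proof.
rewrite /two_n_centralizer card_two_Cent.
have nabG : (0 < #|proper_cents G|)%N -> ~~ abelian G.
  by move=> C_gt0; apply/negP=> /abelian_no_cents[C0]; rewrite C0 in C_gt0.
split=> [c9|[fG|[/eqP-> C7]]].
- have nabG' : ~~ abelian G.
    by apply/negP=> /abelian_no_cents[_ m0]; move: c9; rewrite m0; case: (_ != _).
  have [abC|[_ m10]] := abelian_cents_or_many G; last first.
    by have := leq_addr ('Z(G) != 1%g) #|cent_meets G|; rewrite c9 leqNgt m10.
  move: c9; rewrite card_meets_abelian //.
  have [Z1|/eqP ntZ] := eqVneq 'Z(G) 1; last by rewrite addn1 => -[C7]; right.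
  by rewrite addn0 => -[C8]; left; apply: eight_cents_frob7.
- case: (fG) => N [nsNG oN cN neN].
  rewrite card_meets_abelian ?frob7_nonabelian //;
    last exact: frob7_abelian_cents cN neN.
  by rewrite (frob7_card_cents nsNG oN cN neN) (frob7_center nsNG oN cN neN) eqxx.
- have [abC|[C8 _]] := abelian_cents_or_many G; last by rewrite C7 in C8.
  by rewrite card_meets_abelian ?nabG ?C7.
Qed.

(** * Passage to the central quotient *)

Section CentralQuotient.

Variables (gT : finGroupType) (G : {group gT}).
Let Q := (G / 'Z(G))%G.
Hypotheses (abG : abelian_cents G) (abQ : abelian_cents Q).

Let nZG : G \subset 'N('Z(G)) := normal_norm (center_normal G).

(** Expressed through the subgroup [X] rather than through an element, so that it is a map on
    [proper_cents G]. *)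
Let quotient_cent (X : {set gT}) := 'C_Q(X / 'Z(G)).

(** ['C_G[x] / 'Z(G)] contains the image of [x] and lies in the centralizer of that image, which is
    abelian; this gives the two inclusions. *)
Lemma quotient_centE x : x \in G -> coset 'Z(G) x \notin 'Z(Q) ->
  x \notin 'Z(G) /\ quotient_cent 'C_G[x] = 'C_Q[coset 'Z(G) x].
Proof.
move=> xG nQx; have nx : x \notin 'Z(G).
  by apply: contra nQx => xZ; rewrite coset_id ?group1.
split=> //; set y := coset _ x in nQx *; set X := 'C_G[x].
have yQ : y \in Q by apply: mem_quotient.
have sXy : X / 'Z(G) \subset 'C_Q[y].
  rewrite subsetI quotientS ?subsetIl //= -cent_set1.
  apply: subset_trans (quotient_cents _ (abG xG nx)) _.
  by rewrite centS // sub1set mem_quotient ?cent1_id.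
apply/eqP; rewrite eqEsubset setIS /=.
  by rewrite subsetI subsetIl (subset_trans (abQ yQ nQx)) // centS.
by rewrite -cent_set1 centS // sub1set mem_quotient ?cent1_id.
Qed.

Lemma proper_cents_quotient : proper_cents Q \subset quotient_cent @: proper_cents G.
Proof.
apply/subsetP=> _ /proper_centsP[y /setDP[/morphimP[x _ xG ->] nQx] ->].
have [nx <-] := quotient_centE xG nQx.
by apply: imset_f; apply: mem_proper_cents.
Qed.

Lemma card_proper_cents_quotient : (#|proper_cents Q| <= #|proper_cents G|)%N.
Proof.
exact: leq_trans (subset_leq_card proper_cents_quotient) (leq_imset_card _ _).
Qed.

(* Equality makes [quotient_cent] injective. For [z] mapping into the center
   of [Q] and [g] not, [g] and [g * z] have the same centralizer in [Q], hence
   in [G], so [z] commutes with [g]; and such [g] generate [G]. *)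
Lemma quotient_center1 : ~~ abelian Q ->
  #|proper_cents Q| = #|proper_cents G| -> 'Z(Q) = 1.
Proof.
move=> nabQ eqC; have /imset_injP inj : #|quotient_cent @: proper_cents G| == #|proper_cents G|.
  by rewrite eqn_leq leq_imset_card -eqC subset_leq_card ?proper_cents_quotient.
have [_ [_ [/morphimP[g0 _ g0G ->] _ ng0 _ _]]] := nonabelian_noncentral nabQ.
apply/trivgP/subsetP=> _ /setIP[/morphimP[z nz zG ->] cQz]; rewrite inE.
have zQ : coset 'Z(G) z \in 'Z(Q) by rewrite inE mem_quotient.
have comm g : g \in G -> coset 'Z(G) g \notin 'Z(Q) -> commute z g.
  move=> gG ng; have gzG := groupM gG zG.
  have Egz : coset 'Z(G) (g * z) = coset 'Z(G) g * coset 'Z(G) z.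
    by rewrite morphM ?(subsetP nZG).
  have ngz : coset 'Z(G) (g * z) \notin 'Z(Q) by rewrite Egz groupMr.
  have [nG EG] := quotient_centE gG ng; have [nGz EGz] := quotient_centE gzG ngz.
  have EC : 'C_G[g * z] = 'C_G[g].
    apply: inj; rewrite ?mem_proper_cents // EG EGz Egz.
    apply/setP=> u; rewrite !in_setI; case uQ: (u \in Q) => //=.
    have zu : coset 'Z(G) z \in 'C[u] by apply/cent1P/(centP cQz).
    by rewrite cent1C groupMr // cent1C.
  by have := cent1_id gzG; rewrite EC groupMl ?cent1_id // => /setIP[_ /cent1P].
suff zZ : z \in 'Z(G) by rewrite /= coset_id.
rewrite inE zG; apply/centP=> h hG; have [hQ|nh] := boolP (coset 'Z(G) h \in 'Z(Q));
  last exact: comm.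
(* When [h] maps into ['Z(Q)], both [g0] and [g0 * h] map outside it, so [z] commutes with both and
   hence with [h]. *)
have : commute z (g0 * h).
  by apply: comm; rewrite ?groupM // morphM ?(subsetP nZG) // groupMr.
have /cent1P := comm g0 g0G ng0 => cg0 /cent1P; rewrite cent1C.
by rewrite groupMl; [rewrite cent1C => /cent1P | rewrite cent1C].
Qed.

End CentralQuotient.

Theorem theorem4p9 (gT : finGroupType) (G : {group gT}) :
  (two_n_centralizer G 9 <->
     [\/ G \isog 'D_14,
         G \isog [set: Hol [set: 'Z_7]%G],
         ~~ abelian G /\ #|G| = 21
       | n_centralizer G 8 /\ 'Z(G) <> 1])
  /\
  (primitive_two_n_centralizer G 9 <->
     [\/ G \isog 'D_14,
         G \isog [set: Hol [set: 'Z_7]%G]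
       | ~~ abelian G /\ #|G| = 21]).
Proof.
split.
  apply: (iff_trans (two_nine_centralizerP G)); rewrite /n_centralizer card_Cent.
  split=> [[/frob7P[H|H|H]|[ntZ ->]]|[H|H|H|[[C7] ntZ]]].
  - by constructor 1.
  - by constructor 2.
  - by constructor 3.
  - by constructor 4.
  - by left; apply/frob7P; constructor 1.
  - by left; apply/frob7P; constructor 2.
  - by left; apply/frob7P; constructor 3.
  - by right.
apply: (iff_trans _ (frob7P G)); split=> [[/two_nine_centralizerP G9 /two_nine_centralizerP Q9]|fG];
  last first.
  split; first by apply/two_nine_centralizerP; left.
  (* The center is trivial, so the quotient is isomorphic to [G]. *)
  apply/two_nine_centralizerP; left; apply: frob7_morphim (fG).
  case: (fG) => N [nsNG oN cN neN]; rewrite /= (frob7_center nsNG oN cN neN).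
  exact: quotient1_isog.
case: G9 => // -[ntZ C7].
have [abG|[C8 _]] := abelian_cents_or_many G; last by rewrite C7 in C8.
(* The quotient has at most the seven centralizers of [G]: a [frob7] quotient would have eight, and
   exactly seven would force its center to be trivial. *)
case: Q9 => [fQ|[ntZQ C7Q]].
  case: (fQ) => N [nsNQ oN cN neN].
  have := card_proper_cents_quotient abG (frob7_abelian_cents nsNQ oN cN neN).
  by rewrite C7 (frob7_card_cents nsNQ oN cN neN).
have [abQ|[C8 _]] := abelian_cents_or_many (G / 'Z(G))%G; last by rewrite C7Q in C8.
case: ntZQ; apply: quotient_center1 => //; last by rewrite C7 C7Q.
by apply/negP=> /abelian_no_cents[C0 _]; rewrite C0 in C7Q.
Qed.
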